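(* Let $\lambda$ be an infinite cardinal satisfying $\lambda=\lambda^{\aleph_0}$. Then there exists no universal torsion group of cardinality $\lambda$, i.e. no torsion group $G$ of cardinality $\lambda$ such that every torsion group of cardinality at most $\lambda$ embeds into $G$; and there is not even a torsion group $G$ of cardinality $\lambda$ such that every locally finite group of cardinality at most $\lambda$ embeds into $G$.
   Context: A torsion group is a group all of whose elements have finite order. A group is locally finite if every finitely generated subgroup is finite. ''Embeds'' means there is an injective group homomorphism. *)

(* Defs.v *)
From HB Require Import structures.
From mathcomp Require Import all_boot.
From mathcomp Require Import boolp classical_sets functions cardinality.

Set Implicit Arguments.
Unset Strict Implicit.
Unset Printing Implicit Defensive.

Local Open Scope group_scope.
Local Open Scope classical_set_scope.

Definition torsion_group (G : groupType) : Prop :=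
  forall x : G, exists2 n : nat, (0 < n)%N & x ^+ n = 1.

Definition is_subgroup (G : groupType) (K : set G) : Prop :=
  group_closed (fun x => x \in K).

Definition generated_subgroup (G : groupType) (S : set G) : set G :=
  smallest (@is_subgroup G) S.

Definition finitely_generated (G : groupType) (K : set G) : Prop :=
  exists2 S : set G, finite_set S & K = generated_subgroup S.

Definition locally_finite_group (G : groupType) : Prop :=
  forall K : set G, is_subgroup K -> finitely_generated K -> finite_set K.

Definition group_embeds (H G : groupType) : Prop :=
  exists f : {multiplicative H -> G}, injective f.

(* Main.v *)
(* Given a torsion group G of cardinality lambda, a locally finite
   group H of cardinality lambda is built that does not embed into G.  It has
   generators x_nu, for nu a finite sequence of elements of G, and y_eta, for
   eta : nat -> G.  Conjugation by the involution y_eta permutes the elements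
   x_(eta|n) along the branch eta, by one of two involutions of the levels:
   2n <-> 2n+1, or 2n+1 <-> 2n+2 with 0 fixed.  No torsion group contains
   elements realizing both on the same injective sequence, as their product
   would act on it by 2n |-> 2n+2; so the type of y_eta can be chosen as one
   that no element of G realizes on the sequence eta.  If f embeds H into G,
   the branch defined by eta(n) = f(x_(eta|n)) yields a contradiction.
   Concretely, H consists of the permutations of (finite sequences) x bool that
   agree, up to finitely many points, with a product of y's.  The y's are
   involutions that commute modulo finitary permutations, hence H is an extension
   of a locally finite group by an elementary abelian 2-group. *)

Require Import Defs.
From HB Require Import structures.
From mathcomp Require Import all_boot.
From mathcomp Require Import boolp classical_sets functions cardinality.

Set Implicit Arguments.
Unset Strict Implicit.
Unset Printing Implicit Defensive.

Local Open Scope classical_set_scope.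
Local Open Scope card_scope.

(** * Cardinal arithmetic from countable sequences *)

Lemma set_inj_card_le (T U : Type) (A : set T) (B : set U) (f : T -> U) :
  set_fun A B f -> set_inj A f -> A #<= B.
Proof.
move=> fAB f_inj; have /injfunPex[g] : exists2 f, set_fun A B f & set_inj A f.
  by exists f.
exact: inj_card_le.
Qed.

Lemma card_leTP (A B : Type) :
  [set: A] #<= [set: B] <-> exists f : A -> B, injective f.
Proof.
split=> [/card_leP[f]|[f f_inj]].
  exists (fun a => val (f (to_setT a))) => x y /val_inj fxy.
  by have /(congr1 val) := in2TT 'inj_f _ _ fxy.
by apply: (set_inj_card_le (f := f)) => //; apply: in2W.
Qed.

(** The pair of a and b is coded by the sequence a, b, b, b, ... *)
Lemma card_le_prod (L A B : Type) : [set: nat -> L] #<= [set: L] ->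
  [set: A] #<= [set: L] -> [set: B] #<= [set: L] -> [set: A * B] #<= [set: L].
Proof.
move=> /card_leTP[c c_inj] /card_leTP[f f_inj] /card_leTP[g g_inj].
apply/card_leTP.
exists (fun ab => c (fun n => if n is 0 then f ab.1 else g ab.2)).
move=> [a b] [a' b'] /c_inj /= e.
by rewrite (f_inj _ _ (congr1 (@^~ 0) e)) (g_inj _ _ (congr1 (@^~ 1) e)).
Qed.

Lemma card_le_fun (L A : Type) : [set: nat -> L] #<= [set: L] ->
  [set: A] #<= [set: L] -> [set: nat -> A] #<= [set: L].
Proof.
move=> /card_leTP[c c_inj] /card_leTP[f f_inj]; apply/card_leTP.
exists (fun u => c (f \o u)) => u v /c_inj e; apply/funext => n.
exact/f_inj/(congr1 (@^~ n) e).
Qed.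

Lemma card_le_seq (L A : Type) : infinite_set [set: L] ->
  [set: nat -> L] #<= [set: L] ->
  [set: A] #<= [set: L] -> [set: seq A] #<= [set: L].
Proof.
move=> /infiniteP natL LL /card_leTP[f f_inj].
have [l _] : exists l : L, True.
  by have /card_leTP[g _] := natL; exists (g 0).
apply: (@card_le_trans _ _ _ [set: nat * (nat -> L)]); last first.
  exact: card_le_prod.
(* Padding with the default [l] loses nothing, as the length is recorded as well. *)
apply/card_leTP; exists (fun s => (size s, nth l (map f s))) => s t [st e].
apply: (inj_map f_inj); apply: (@eq_from_nth _ l); first by rewrite !size_map.
by move=> i _; rewrite e.
Qed.

Local Open Scope group_scope.

(** * Locally finite groups: torsion and extensions *)

Lemma locally_finite_torsion (G : groupType) :
  locally_finite_group G -> torsion_group G.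
Proof.
move=> Gfin x; pose K := generated_subgroup [set x].
have Ksub : is_subgroup K.
  split; first by apply/mem_set => M [[/set_mem]].
  move=> u v /set_mem Ku /set_mem Kv; apply/mem_set => M MP.
  by have [/= [_ ]] := MP; move=> /(_ u v) /[swap] _ Md;
    apply/set_mem/Md; apply/mem_set; [apply: Ku|apply: Kv].
have Kx n : K (x ^+ n).
  move=> M [Msub Mx]; elim: n => [|n IHn]; first by case: Msub => /set_mem.
  rewrite expgS; apply/set_mem/(group_closedM Msub); apply/mem_set => //.
  exact: Mx.
have Kfin : finite_set K.
  by apply: Gfin => //; exists [set x] => //; exact: finite_set1.
have [m [n [mn e]]] : exists m n, (m < n)%N /\ x ^+ m = x ^+ n.
  apply/not_existsP => no; have /finite_setPn := Kfin; apply.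
  suff pow_inj : injective (fun n => x ^+ n).
    apply: (set_inj_card_le (f := fun n => x ^+ n)); last exact: in2W.
    by move=> n _; apply: Kx.
  move=> m n e; apply/eqP; apply: contrapT => /negP.
  rewrite neq_ltn => /orP[mn|nm].
    by apply: (no m); exists n.
  by apply: (no n); exists m.
exists (n - m); first by rewrite subn_gt0.
by apply: (mulgI (x ^+ m)); rewrite -expgnDr subnKC ?mulg1// ltnW.
Qed.

(* Schreier's argument: [R] is a finite set of representatives of the cosets met
   by products of elements of [s]. *)
Lemma finite_representatives (G : groupType) (E : G -> G -> Prop)
    (E_refl : forall x, E x x)
    (E_trans : forall x y z, E x y -> E y z -> E x z)
    (E_mull : forall z x y, E x y -> E (z * x) (z * y))
    (E_mulr : forall z x y, E x y -> E (x * z) (y * z))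
    (E_comm : forall x y, E (x * y) (y * x))
    (E_sqr : forall x, E (x * x) 1) (s : seq G) :
  exists R : seq G, 1 \in R /\
    {in R & s, forall r y, exists2 r', r' \in R & E (r * y) r'}.
Proof.
elim: s => [|y s [R [R1 Rs]]]; first by exists [:: 1]; rewrite mem_head.
(* Squares are trivial modulo [E], so a new [y] at most doubles the representatives. *)
exists (R ++ [seq r * y | r <- R]); split; first by rewrite mem_cat R1.
move=> r z; rewrite mem_cat inE => rR /predU1P[->{z}|zs].
  case/orP: rR => [rR|/mapP[q qR ->]].
    exists (r * y); rewrite // mem_cat.
    by apply/orP; right; apply/mapP; exists r.
  exists q; first by rewrite mem_cat qR.
  by rewrite -mulgA -[X in E _ X]mulg1; apply: E_mull.
case/orP: rR => [rR|/mapP[q qR ->]].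
  by have [q qR ?] := Rs r z rR zs; exists q; rewrite // mem_cat qR.
have [p pR Ep] := Rs q z qR zs.
exists (p * y).
  by rewrite mem_cat; apply/orP; right; apply/mapP; exists p.
(* [E_comm] moves [z] past [y], next to the old representative [q]. *)
apply: (E_trans _ (q * z * y)); last exact: E_mulr.
by rewrite -!mulgA; apply: E_mull.
Qed.

(** [E] stands for congruence modulo a normal subgroup with elementary abelian 2-quotient. The
    finitely many Schreier elements lie in a finite [Q] closed under products, and the finite set of
    all [q * r] is then stable under right multiplication by the generators. *)
Lemma locally_finite_extension (G : groupType) (E : G -> G -> Prop)
    (E_refl : forall x, E x x)
    (E_trans : forall x y z, E x y -> E y z -> E x z)
    (E_mull : forall z x y, E x y -> E (z * x) (z * y))
    (E_mulr : forall z x y, E x y -> E (x * z) (y * z))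
    (E_comm : forall x y, E (x * y) (y * x))
    (E_sqr : forall x, E (x * x) 1)
    (E_fin : forall A : set G, finite_set A -> A `<=` [set x | E x 1] ->
       exists Q : set G, [/\ finite_set Q, Q 1, A `<=` Q &
                            forall x y, Q x -> Q y -> Q (x * y)]) :
  locally_finite_group G.
Proof.
move=> _ _ [S /finite_seqP[s ->] ->]; pose s' := s ++ [seq y^-1 | y <- s].
have [R [R1 Rs]] :=
  finite_representatives E_refl E_trans E_mull E_mulr E_comm E_sqr s'.
(* The Schreier elements [r * y / q] that are trivial modulo [E]. *)
pose A := [set x | E x 1] `&` 
  [set u / q | u in [set r * y | r in [set` R] & y in [set` s']] & q in [set` R]].
have [||Q [Qfin Q1 AQ QM]] := E_fin A.
- by apply: finite_setIr; do !apply: finite_image2.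
- by move=> x [].
pose T := [set q * r | q in Q & r in [set` R]].
have Tfin : finite_set T by apply: finite_image2.
have T1 : T 1 by exists 1 => //; exists 1; rewrite // mulg1.
have TM y x : y \in s' -> T x -> T (x * y).
  move=> ys [q Qq [r rR <-]]; have [p pR Ep] := Rs r y rR ys.
  exists (q * (r * y / p)); last by exists p; rewrite // -!mulgA mulVg mulg1.
  apply: QM => //; apply: AQ; split.
    by rewrite /= -(mulgV p); apply: E_mulr.
  by exists (r * y); [exists r => //; exists y | exists p].
apply: sub_finite_set Tfin.
(* The equivalence makes this right stabilizer of [T] a subgroup; the inverses in [s'] give its
   converse half for the generators. Since [T 1] holds, [M] lies in [T]. *)
pose M := [set g | forall x, T x <-> T (x * g)].
suff KM : generated_subgroup [set` s] `<=` M.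
  by move=> g /KM /(_ 1); rewrite mul1g => <-.
apply: smallest_sub => [|g gs].
  split=> [|g h /set_mem Mg /set_mem Mh]; apply/mem_set => x.
    by rewrite mulg1.
  by rewrite (Mh (x * (g / h))) -!mulgA mulVg mulg1; apply: Mg.
move=> x; split; first by apply: TM; rewrite mem_cat gs.
move=> /(TM g^-1); rewrite -mulgA mulgV mulg1; apply.
by rewrite mem_cat map_f ?orbT.
Qed.


Local Close Scope group_scope.

(** * Equality up to finitely many points, and the branch involutions *)

Definition fineq (X : Type) (f g : X -> X) : Prop :=
  finite_set [set z | f z <> g z].

Lemma fineq_refl (X : Type) (f : X -> X) : fineq f f.
Proof. by apply: sub_finite_set (finite_set0 X) => z /(_ erefl). Qed.

Lemma fineq_sym (X : Type) (f g : X -> X) : fineq f g -> fineq g f.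
Proof. by apply: sub_finite_set => z /nesym. Qed.

Lemma fineq_trans (X : Type) (f g h : X -> X) :
  fineq f g -> fineq g h -> fineq f h.
Proof.
move=> fg gh.
have fgh : finite_set ([set z | f z <> g z] `|` [set z | g z <> h z]).
  by rewrite finite_setU.
apply: sub_finite_set fgh => z /= fhz.
by have [fgz|] := pselect (f z = g z); [right; rewrite -fgz | left].
Qed.

Lemma fineq_compl (X : Type) (h f g : X -> X) :
  fineq f g -> fineq (h \o f) (h \o g).
Proof. by apply: sub_finite_set => z /= hz fg; apply: hz; rewrite fg. Qed.

Lemma fineq_compr (X : Type) (h f g : X -> X) : injective h ->
  fineq f g -> fineq (f \o h) (g \o h).
Proof. by move=> h_inj; apply: finite_preimage; apply: in2W. Qed.

(* [t = false] swaps [2n] and [2n + 1]; [t = true] swaps [2n + 1] and [2n + 2],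
   and [0.-1 = 0] is then a fixed point. *)
Definition zigzag (t : bool) (n : nat) : nat :=
  if odd n (+) t then n.-1 else n.+1.

Lemma zigzagK t : involutive (zigzag t).
Proof.
by rewrite /zigzag; case: t => -[|n] //=; case no: (odd n); rewrite /= ?no.
Qed.

(** A level drops by at most one, so a node far beyond the splitting point of two branches stays
    beyond it. *)
Lemma leq_zigzag t n : n <= (zigzag t n).+1.
Proof. by rewrite /zigzag; case: ifP; case: n => //= n _; rewrite ltnW. Qed.

(* The generator y_eta, acting on the tree. *)
Definition branch_swap (A : eqType) (t : bool) (eta : nat -> A)
    (z : seq A * bool) : seq A * bool :=
  if z.1 == mkseq eta (size z.1)
  then (mkseq eta (zigzag t (size z.1)), z.2) else z.

Lemma branch_swap_on (A : eqType) t (eta : nat -> A) n b :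
  branch_swap t eta (mkseq eta n, b) = (mkseq eta (zigzag t n), b).
Proof. by rewrite /branch_swap /= size_mkseq eqxx. Qed.

Lemma branch_swap_off (A : eqType) t (eta : nat -> A) z :
  z.1 != mkseq eta (size z.1) -> branch_swap t eta z = z.
Proof. by rewrite /branch_swap => /negPf ->. Qed.

Lemma branch_swapK (A : eqType) t (eta : nat -> A) :
  involutive (branch_swap t eta).
Proof.
move=> z; have [|zN] := eqVneq z.1 (mkseq eta (size z.1)); last first.
  by rewrite !branch_swap_off.
by case: z => nu b /= ->; rewrite !branch_swap_on zigzagK.
Qed.

(** Distinct branches share only finitely many nodes; beyond these, each swap fixes the nodes of the
    other branch. *)
Lemma branch_swapC (A : eqType) t t' (eta zeta : nat -> A) : eta <> zeta ->
  fineq (branch_swap t eta \o branch_swap t' zeta)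
        (branch_swap t' zeta \o branch_swap t eta).
Proof.
move=> eta_zeta.
have [N etaN] : exists N, eta N <> zeta N.
  by apply/existsNP => e; apply: eta_zeta; apply/funext.
have apart n : N < n -> mkseq eta n != mkseq zeta n.
  move=> Nn; apply/eqP => /(congr1 (nth (eta 0) ^~ N)).
  by rewrite !nth_mkseq.
(* Prefixes of length above [N] differ. The bound [N.+2] keeps the length above [N] even after a
   swap. *)
pose B xi : set (seq A * bool) :=
  [set (mkseq xi n, b) | n in `I_N.+2 & b in [set: bool]].
have Bfin : finite_set (B eta `|` B zeta).
  by rewrite finite_setU; split; apply: finite_image2 => //; exact: finite_II.
apply: sub_finite_set Bfin => -[nu b] /=.
have far n t0 : N.+2 <= n -> N < zigzag t0 n.
  by move=> Nn; have := leq_trans Nn (leq_zigzag t0 n).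
have offP t0 c (xi xi' : nat -> A) n : mkseq xi n != mkseq xi' n ->
  branch_swap t0 xi' (mkseq xi n, c) = (mkseq xi n, c).
  by move=> ?; rewrite branch_swap_off //= size_mkseq.
have [->|nu_eta] := eqVneq nu (mkseq eta (size nu)).
  set n := size nu; have [nN _|Nn] := ltnP n N.+2.
    by left; exists n => //; exists b.
  have := far n t Nn => /apart e1; have := apart n (ltnW Nn) => e2.
  by rewrite (offP _ _ _ _ _ e2) !branch_swap_on (offP _ _ _ _ _ e1).
have [->|nu_zeta] := eqVneq nu (mkseq zeta (size nu)).
  set n := size nu; have [nN _|Nn] := ltnP n N.+2.
    by right; exists n => //; exists b.
  have := far n t' Nn => /apart; rewrite eq_sym => e1.
  have := apart n (ltnW Nn); rewrite eq_sym => e2.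
  by rewrite (offP _ _ _ _ _ e2) !branch_swap_on (offP _ _ _ _ _ e1).
by rewrite !branch_swap_off.
Qed.

Definition branch_swaps (A : eqType) (t : (nat -> A) -> bool)
    (l : seq (nat -> A)) : seq A * bool -> seq A * bool :=
  foldr (fun eta h => branch_swap (t eta) eta \o h) id l.

Lemma branch_swaps_cat (A : eqType) t (l l' : seq (nat -> A)) :
  branch_swaps t (l ++ l') = branch_swaps t l \o branch_swaps t l'.
Proof. by elim: l => //= eta l ->. Qed.

Lemma branch_swaps_inj (A : eqType) t (l : seq (nat -> A)) :
  injective (branch_swaps t l).
Proof.
elim: l => //= eta l IHl; apply: inj_comp IHl.
exact/inv_inj/branch_swapK.
Qed.

Lemma branch_swaps_comm1 (A : eqType) t (eta : nat -> A) (l : seq (nat -> A)) :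
  fineq (branch_swap (t eta) eta \o branch_swaps t l)
        (branch_swaps t l \o branch_swap (t eta) eta).
Proof.
elim: l => [|zeta l IHl]; first exact: fineq_refl.
apply: (@fineq_trans _ _ (branch_swap (t zeta) zeta \o
                           (branch_swap (t eta) eta \o branch_swaps t l))).
  have [->|/eqP eta_zeta] := eqVneq eta zeta; first exact: fineq_refl.
  exact: (fineq_compr (@branch_swaps_inj _ t l) (branch_swapC _ _ eta_zeta)).
exact: fineq_compl.
Qed.

Lemma branch_swaps_comm (A : eqType) t (l l' : seq (nat -> A)) :
  fineq (branch_swaps t l \o branch_swaps t l')
        (branch_swaps t l' \o branch_swaps t l).
Proof.
elim: l => [|eta l IHl]; first exact: fineq_refl.
apply: fineq_trans (fineq_compl (branch_swap (t eta) eta) IHl) _.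
exact: (fineq_compr (@branch_swaps_inj _ t l) (branch_swaps_comm1 _ _ _)).
Qed.

(** The head involution commutes past the tail up to finitely many points and cancels with its
    second copy. *)
Lemma branch_swaps_sqr (A : eqType) t (l : seq (nat -> A)) :
  fineq (branch_swaps t l \o branch_swaps t l) id.
Proof.
elim: l => [|eta l IHl]; first exact: fineq_refl.
pose y := branch_swap (t eta) eta.
apply: fineq_trans IHl.
have yy : y \o y \o (branch_swaps t l \o branch_swaps t l) =
          branch_swaps t l \o branch_swaps t l.
  by apply/funext => z /=; rewrite /y branch_swapK.
rewrite -[X in fineq _ X]yy; apply: (@fineq_compl _ y).
exact: fineq_compr (@branch_swaps_inj _ t l)
  (fineq_sym (branch_swaps_comm1 t eta l)).
Qed.

(** * The group of tree permutations *)

(** The inverse is stored as data but is determined by [fwd]; the list of swaps is only asserted to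
    exist, so equality reduces to that of [fwd]. *)
Record tree_perm (A : eqType) (t : (nat -> A) -> bool) := TreePerm {
  fwd : seq A * bool -> seq A * bool;
  bwd : seq A * bool -> seq A * bool;
  fwdK : cancel fwd bwd;
  bwdK : cancel bwd fwd;
  fwd_swaps : exists l, fineq fwd (branch_swaps t l) }.

Lemma tree_permP (A : eqType) t (g h : @tree_perm A t) :
  fwd g =1 fwd h -> g = h.
Proof.
case: g h => [f f' fK f'K Pf] [g g' gK g'K Pg] /= /funext fg.
rewrite {}fg {f} in fK f'K Pf *.
have e : f' = g' by apply/funext => z; rewrite -{1}[z]g'K fK.
rewrite {}e {f'} in fK f'K *.
by congr TreePerm; exact: Prop_irrelevance.
Qed.

Lemma fwd_inj (A : eqType) t (g : @tree_perm A t) : injective (fwd g).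
Proof. exact: can_inj (fwdK g). Qed.

Section TreePermGroup.
Variables (A : eqType) (t : (nat -> A) -> bool).
Implicit Types g h k : tree_perm t.

Lemma tree_perm1_subproof : exists l, fineq id (branch_swaps t l).
Proof. by exists [::]; exact: fineq_refl. Qed.

Definition tree_perm1 : tree_perm t :=
  @TreePerm A t id id (fun=> erefl) (fun=> erefl) tree_perm1_subproof.

Lemma tree_permM_subproof g h :
  exists l, fineq (fwd g \o fwd h) (branch_swaps t l).
Proof.
have [l gl] := fwd_swaps g; have [l' hl'] := fwd_swaps h.
exists (l ++ l'); rewrite branch_swaps_cat.
apply: fineq_trans (fineq_compl _ hl') _.
exact: fineq_compr (@branch_swaps_inj _ t l') gl.
Qed.

Definition tree_permM g h : tree_perm t :=
  TreePerm (can_comp (fwdK g) (fwdK h)) (can_comp (bwdK h) (bwdK g))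
    (tree_permM_subproof g h).

(** The list of [g] also serves its inverse, as a product of swaps is its own inverse up to finitely
    many points. *)
Lemma tree_permV_subproof g : exists l, fineq (bwd g) (branch_swaps t l).
Proof.
have [l gl] := fwd_swaps g; exists l.
apply: (@fineq_trans _ _ (bwd g \o (branch_swaps t l \o branch_swaps t l))).
  exact: (@fineq_compl _ (bwd g) id _ (fineq_sym (branch_swaps_sqr t l))).
have e : bwd g \o fwd g = id by apply/funext => z /=; rewrite fwdK.
have : fineq (bwd g \o branch_swaps t l) id.
  by rewrite -e; exact/fineq_compl/fineq_sym.
exact: fineq_compr (@branch_swaps_inj _ t l).
Qed.

Definition tree_permV g : tree_perm t :=
  TreePerm (bwdK g) (fwdK g) (tree_permV_subproof g).

Lemma tree_permA : associative tree_permM.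
Proof. by move=> g h k; exact: tree_permP. Qed.

Lemma tree_perm1M : left_id tree_perm1 tree_permM.
Proof. by move=> g; exact: tree_permP. Qed.

Lemma tree_permM1 : right_id tree_perm1 tree_permM.
Proof. by move=> g; exact: tree_permP. Qed.

Lemma tree_permVM : left_inverse tree_perm1 tree_permV tree_permM.
Proof. by move=> g; apply: tree_permP => z /=; rewrite fwdK. Qed.

Lemma tree_permMV : right_inverse tree_perm1 tree_permV tree_permM.
Proof. by move=> g; apply: tree_permP => z /=; rewrite bwdK. Qed.

HB.instance Definition _ := gen_eqMixin (tree_perm t).
HB.instance Definition _ := gen_choiceMixin (tree_perm t).
HB.instance Definition _ := isGroup.Build (tree_perm t)
  tree_permA tree_perm1M tree_permM1 tree_permVM tree_permMV.

End TreePermGroup.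

Local Open Scope group_scope.

Lemma fwdM (A : eqType) t (g h : @tree_perm A t) :
  fwd (g * h) = fwd g \o fwd h.
Proof. by []. Qed.

(** * Local finiteness and cardinality of the group *)

(** Such a permutation maps [s] into itself by injectivity, so it is determined by the indices in
    [s] of its values there. *)
Lemma finite_supported_in (A : eqType) (t : (nat -> A) -> bool)
    (s : seq (seq A * bool)) :
  finite_set [set g : tree_perm t | forall z, z \notin s -> fwd g z = z].
Proof.
set Q := [set g | _].
pose f (g : tree_perm t) : {ffun 'I_(size s) -> 'I_(size s).+1} :=
  [ffun i => inord (index (fwd g (tnth (in_tuple s) i)) s)].
have Qs g z : Q g -> z \in s -> fwd g z \in s.
  move=> Qg; apply: contraTT => gz; have := Qg _ gz.
  by move=> /fwd_inj ez; rewrite ez in gz.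
suff : Q #<= [set: {ffun 'I_(size s) -> 'I_(size s).+1}].
  by move=> /card_le_finite; apply; exact: finite_finset.
apply: (set_inj_card_le (f := f)) => // g h /set_mem Qg /set_mem Qh fgh.
apply: tree_permP => z.
have [zs|zs] := boolP (z \in s); last by rewrite Qg // Qh.
have /tnthP[i zi] : z \in in_tuple s by [].
have /ffunP/(_ i) := fgh; rewrite !ffunE -zi => /(congr1 val) /=.
rewrite !inordK ?ltnS ?index_size // => /(congr1 (nth z s)).
by rewrite !nth_index ?Qs.
Qed.

Lemma tree_perm_locally_finite (A : eqType) (t : (nat -> A) -> bool) :
  locally_finite_group (tree_perm t).
Proof.
apply: (@locally_finite_extension _ (fun g h => fineq (fwd g) (fwd h))).
- by move=> g; exact: fineq_refl.
- by move=> g h k; exact: fineq_trans.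
- by move=> k g h; rewrite !fwdM; exact: fineq_compl.
- by move=> k g h; rewrite !fwdM; exact/fineq_compr/fwd_inj.
- move=> g h; have [l gl] := fwd_swaps g; have [l' hl'] := fwd_swaps h.
  have M (k k' : tree_perm t) m m' : fineq (fwd k) (branch_swaps t m) ->
      fineq (fwd k') (branch_swaps t m') ->
      fineq (fwd (k * k')) (branch_swaps t m \o branch_swaps t m').
    move=> km k'm'; apply: fineq_trans (fineq_compl _ k'm') _.
    exact: fineq_compr (@branch_swaps_inj _ t m') km.
  apply: fineq_trans (M _ _ _ _ gl hl') _.
  exact: fineq_trans (branch_swaps_comm t l l') (fineq_sym (M _ _ _ _ hl' gl)).
- move=> g; have [l gl] := fwd_swaps g.
  apply: fineq_trans (fineq_compl (fwd g) gl) _.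
  apply: fineq_trans (branch_swaps_sqr t l).
  exact: fineq_compr (@branch_swaps_inj _ t l) gl.
move=> D Dfin D1.
(* Finitely many finitary permutations have a common finite support [s], and those supported in [s]
   form [Q]. *)
have /finite_seqP[s es] : finite_set (\bigcup_(g in D) [set z | fwd g z <> z]).
  by apply: bigcup_finite => // g /D1.
exists [set g : tree_perm t | forall z, z \notin s -> fwd g z = z].
split=> //; first exact: finite_supported_in.
- move=> g Dg z; apply: contraNeq => gz.
  have : [set` s] z by rewrite -es; exists g => //; apply/eqP.
  by [].
- by move=> g h Qg Qh z zs; rewrite fwdM /= Qh // Qg.
Qed.

(** An element is coded by its list of branches and a finite table of the points where it departs
    from their product. *)
Lemma card_le_tree_perm (L : Type) (A : eqType) (t : (nat -> A) -> bool) :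
  infinite_set [set: L] -> [set: nat -> L] #<= [set: L] ->
  [set: A] #<= [set: L] -> [set: tree_perm t] #<= [set: L].
Proof.
move=> Linf LL AL.
have XL : [set: seq A * bool] #<= [set: L].
  apply: card_le_prod => //; first exact: card_le_seq.
  apply: card_le_trans (finite_set_countable _) _; first exact: finite_finset.
  exact/infiniteP.
pose X := (seq A * bool)%type.
apply: (@card_le_trans _ _ _ [set: seq (nat -> A) * seq (X * X)]); last first.
  apply: card_le_prod => //; apply: card_le_seq => //; first exact: card_le_fun.
  exact: card_le_prod.
pose D (g : tree_perm t) (d : seq (nat -> A) * seq (X * X)) :=
  forall z, fwd g z = if z \in unzip1 d.2
    then (nth (z, z) d.2 (index z (unzip1 d.2))).2
    else branch_swaps t d.1 z.
have [c cP] : {c & forall g, D g (c g)}.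
  apply: choice => g; have [l /finite_seqP[s es]] := fwd_swaps g.
  exists (l, [seq (z, fwd g z) | z <- s]) => z.
  rewrite /unzip1 -map_comp map_id_in //=; case: ifPn => [zs|].
    by rewrite (nth_map z) ?index_mem //= nth_index.
  apply: contraNeq => /eqP zl.
  have : [set` s] z by rewrite -es.
  by [].
apply/card_leTP; exists c => g h cgh; apply: tree_permP => z.
by rewrite cP cgh -cP.
Qed.

(** * The generators as group elements, and the failure to embed *)

(* The generator x_nu. *)
Definition flip (A : eqType) (nu : seq A) (z : seq A * bool) : seq A * bool :=
  (z.1, z.2 (+) (z.1 == nu)).

Lemma flipK (A : eqType) (nu : seq A) : involutive (flip nu).
Proof. by case=> mu b; rewrite /flip /= -addbA addbb addbF. Qed.

(** A flip moves only the two points over [nu], so the empty product suffices. *)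
Lemma flip_swaps (A : eqType) (t : (nat -> A) -> bool) (nu : seq A) :
  exists l, fineq (flip nu) (branch_swaps t l).
Proof.
exists [::]; have fin : finite_set [set (nu, b) | b in [set: bool]].
  exact: finite_image.
apply: sub_finite_set fin => -[mu b] /=; rewrite /flip /=.
by case: eqP => [->|_]; [exists b | rewrite addbF].
Qed.

Definition flip_perm (A : eqType) (t : (nat -> A) -> bool) (nu : seq A) :
    tree_perm t :=
  TreePerm (flipK nu) (flipK nu) (flip_swaps t nu).

Lemma flip_perm_inj (A : eqType) (t : (nat -> A) -> bool) :
  injective (flip_perm t).
Proof.
move=> nu mu /(congr1 (fun g => (fwd g (nu, false)).2)) /=.
by rewrite eqxx => /esym/eqP.
Qed.

Lemma swap_perm_subproof (A : eqType) (t : (nat -> A) -> bool) (eta : nat -> A) :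
  exists l, fineq (branch_swap (t eta) eta) (branch_swaps t l).
Proof. by exists [:: eta]; exact: fineq_refl. Qed.

Definition swap_perm (A : eqType) (t : (nat -> A) -> bool) (eta : nat -> A) :
    tree_perm t :=
  TreePerm (@branch_swapK A (t eta) eta) (@branch_swapK A (t eta) eta)
    (swap_perm_subproof t eta).

Lemma swap_flip (A : eqType) (t : (nat -> A) -> bool) (eta : nat -> A) n :
  swap_perm t eta * flip_perm t (mkseq eta n) =
  flip_perm t (mkseq eta (zigzag (t eta) n)) * swap_perm t eta.
Proof.
apply: tree_permP => -[mu b]; rewrite !fwdM /= /flip /=.
set n' := zigzag _ n.
have mkseqE m k : (mkseq eta m == mkseq eta k) = (m == k).
  by apply/eqP/eqP => [/(congr1 size)|->//]; rewrite !size_mkseq.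
have [e|muN] := eqVneq mu (mkseq eta (size mu)).
  by rewrite e !branch_swap_on /= !mkseqE (inj_eq (inv_inj (@zigzagK _))).
rewrite !branch_swap_off //=; congr (_, _ (+) _).
by apply/eqP/eqP => emu; rewrite emu size_mkseq eqxx in muN.
Qed.

(* The zigzags of types [false] and [true] compose to [2n |-> 2n + 2]. *)
Lemma zigzag_witnesses (G : groupType) (a : nat -> G) (y y' : G) :
  torsion_group G -> injective a ->
  (forall n, y * a n = a (zigzag false n) * y) ->
  (forall n, y' * a n = a (zigzag true n) * y') -> False.
Proof.
move=> tG a_inj ya y'a; have [k k_gt0 wk] := tG (y' * y).
have step n : y' * y * a n.*2 = a n.+1.*2 * (y' * y).
  by rewrite -mulgA ya mulgA y'a mulgA /zigzag odd_double /= odd_double.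
have steps n m : (y' * y) ^+ n * a m.*2 = a (m + n).*2 * (y' * y) ^+ n.
  elim: n m => [|n IHn] m; first by rewrite addn0 !expg0 mul1g mulg1.
  by rewrite expgSr -[LHS]mulgA step mulgA IHn addSnnS -[LHS]mulgA.
(* The [k]-th power is 1, yet it carries level 0 to level [k.*2]. *)
have := steps k 0; rewrite wk mul1g mulg1 => /a_inj /esym/eqP.
by rewrite add0n double_eq0 -leqn0 leqNgt k_gt0.
Qed.

Lemma tree_perm_not_embed (G : groupType) : torsion_group G ->
  exists t : (nat -> G) -> bool, ~ group_embeds (tree_perm t) G.
Proof.
move=> tG.
(* Diagonal choice: type [true] exactly when [G] realizes type [false] on [eta]. *)
pose t (eta : nat -> G) :=
  `[< exists y, forall n, y * eta n = eta (zigzag false n) * y >].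
exists t => -[f f_inj].
(* Each node is extended by the image of its own flip, so the [nu n] are the prefixes of [eta]. *)
pose nu := fix nu n : seq G :=
  if n is m.+1 then rcons (nu m) (f (flip_perm t (nu m))) else [::].
pose eta n := f (flip_perm t (nu n)).
have nuE n : nu n = mkseq eta n.
  by elim: n => //= n IHn; rewrite mkseqS -IHn.
have eta_inj : injective eta.
  move=> m n /f_inj/flip_perm_inj; rewrite !nuE => /(congr1 size).
  by rewrite !size_mkseq.
have f_swap n : f (swap_perm t eta) * eta n =
                eta (zigzag (t eta) n) * f (swap_perm t eta).
  by rewrite /eta !nuE -!gmulfM swap_flip.
case: (boolP (t eta)) => teta.
  have /asboolP[y yP] := teta.
  by rewrite teta in f_swap; apply: zigzag_witnesses yP f_swap.
case/asboolP: (teta); exists (f (swap_perm t eta)).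
by rewrite (negPf teta) in f_swap.
Qed.

Local Close Scope group_scope.

Theorem proposition1p4 (L : Type)
    (L_infinite : infinite_set [set: L])
    (L_omega : [set: L] #= [set: nat -> L]) :
  (~ exists G : groupType,
      [/\ torsion_group G,
          [set: G] #= [set: L] &
          forall H : groupType,
            torsion_group H -> [set: H] #<= [set: L] -> group_embeds H G])
  /\
  (~ exists G : groupType,
      [/\ torsion_group G,
          [set: G] #= [set: L] &
          forall H : groupType,
            locally_finite_group H -> [set: H] #<= [set: L] ->
            group_embeds H G]).
Proof.
(* The second claim gives the first, since locally finite groups are torsion. *)
suff no_lf : ~ exists G : groupType,
    [/\ torsion_group G, [set: G] #= [set: L] &
        forall H : groupType, locally_finite_group H ->
          [set: H] #<= [set: L] -> group_embeds H G].
  split=> // -[G [tG GL univ]]; apply: no_lf; exists G; split=> // H Hlf.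
  exact/univ/locally_finite_torsion.
case=> G [tG /card_eqPle[GL _] univ].
(* The tree is labelled by [G] itself, whose cardinality is at most that of [L]. *)
have [t] := tree_perm_not_embed tG; apply; apply: univ.
  exact: tree_perm_locally_finite.
by apply: card_le_tree_perm => //; have /card_eqPle[] := L_omega.
Qed.
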